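(* Let $q$ be a power of an odd prime, $R=\mathbf{F}_q[T]$, $k=\mathbf{F}_q(T)$. Let $P\in R$ be irreducible, $c\in\mathbf{F}_q^\times$, and let $S,H\in R$ with $H\neq 0$ and $\deg S>\deg P$. Let $D=(SHP)^2+cS$, and assume that $D$ is square-free and monic (so $K=k(\sqrt{D})$ is a real quadratic function field). If $(cS/P)=1$, then the ideal class number $h(D)$ of $K$ satisfies $$h(D)\ge \frac{\deg S}{\deg P}>1.$$
   Context: The ring of integers $\mathcal{O}_K$ of $K$ is the integral closure of $R=\mathbf{F}_q[T]$ in $K$. The ideal class number $h(D)=h(K)$ is the order of the group of fractional ideals of $\mathcal{O}_K$ modulo principal fractional ideals. For $F\in R$ not divisible by the irreducible polynomial $P$, $(F/P)$ is the quadratic residue symbol: $(F/P)=1$ if $F$ is a quadratic residue modulo $P$, and $(F/P)=-1$ otherwise. *)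

(* Defs.v *)
From HB Require Import structures.
From mathcomp Require Import all_boot all_order all_algebra all_field.
From mathcomp Require Import finmap.
From mathcomp Require Import boolp classical_sets functions cardinality.

Set Implicit Arguments.
Unset Strict Implicit.
Unset Printing Implicit Defensive.

Import Order.TTheory GRing.Theory Num.Theory.
Local Open Scope ring_scope.
Local Open Scope classical_set_scope.

Definition pdeg (F : fieldType) (A : {poly F}) : nat := (size A).-1.

Definition squarefree_poly (F : fieldType) (A : {poly F}) : Prop :=
  forall Q : {poly F}, size Q != 1%N -> ~~ (Q ^+ 2 %| A).

(* The symbol (A/P), for P irreducible. It is extended by 0 when P divides A,
   so that (A/P) = 1 includes the condition that P does not divide A. *)
Definition qr_symbol (F : fieldType) (A P : {poly F}) : int :=
  if P %| A then 0
  else if `[< exists X : {poly F}, P %| X ^+ 2 - A >] then 1 else -1.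

Section ClassNumber.
Variables (F : fieldType) (K : fieldExtType {fraction {poly F}}).
Implicit Types (I J : set K).

Definition poly_embed (A : {poly F}) : K := (FracField.tofrac A)%:A.

Definition ring_of_integers : set K :=
  [set x | integralOver poly_embed x].

Definition fractional_ideal : set (set K) :=
  [set I | [/\ I 0,
               forall x y, I x -> I y -> I (x + y),
               forall a x, ring_of_integers a -> I x -> I (a * x),
               exists2 x, I x & x != 0
             & exists a, [/\ ring_of_integers a, a != 0
                 & forall x, I x -> ring_of_integers (a * x)]]].

Definition ideal_mul I J : set K :=
  [set z | exists n (x y : 'I_n -> K),
     [/\ forall i, I (x i), forall i, J (y i) & z = \sum_(i < n) x i * y i]].

Definition principal_ideal (x : K) : set K :=
  [set x * a | a in ring_of_integers].

Definition principal_ideals : set (set K) :=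
  [set principal_ideal x | x in [set x | x != 0]].

Definition ideal_class I : set (set K) :=
  [set ideal_mul I J | J in principal_ideals].

(* The underlying set of the ideal class group: the cosets of the subgroup of
   principal fractional ideals in the group of fractional ideals. *)
Definition ideal_class_group : set (set (set K)) :=
  [set ideal_class I | I in fractional_ideal].

(* fset_set sends an infinite set to fset0, so a positive value of
   class_number entails that the class group is finite. *)
Definition class_number : nat := #|` fset_set ideal_class_group|%fset.

End ClassNumber.

(* Main.v *)
Require Import Defs.
From HB Require Import structures.
From mathcomp Require Import all_boot all_order all_algebra all_field.
From mathcomp Require Import finmap.
From mathcomp Require Import boolp classical_sets cardinality.
From mathcomp Require Import ring zify.

Import Order.TTheory GRing.Theory Num.Theory.
Local Open Scope ring_scope.

(* Since D = cS mod P is a nonzero square mod P, it has a square root b modulo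
   every power of P, which yields the ideals
   I_i = {x + y sqrt D : P^i | x - y b}, the powers of a prime above P.
   If I_i and I_j are in the same class, i < j, a generator x + y sqrt D of
   their quotient has norm associate to P^(j-i). The form x^2 - D y^2 represents
   a polynomial A with deg A < deg S only as A = z^2 with z | x and z | y:
   for a suitable sign of x, dividing by the unit (SHP + sqrt D)^2 / S strictly
   decreases deg y while y <> 0. Taking the factor z out then contradicts P^(j-i) | x - y b
   when (j - i) deg P < deg S, so the I_i with i deg P < deg S lie in distinct
   classes. The class group is finite by Hurwitz's argument: every class
   contains an ideal between tau O_K and O_K for a fixed nonzero tau. *)

(** * Values of the form [x^2 - D y^2] and powers of [P] *)

Section PolynomialNorms.
Variable F : fieldType.
Implicit Types (P S G D A N b x y z : {poly F}) (c : F).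

(* These instances keep the sizes in a single syntactic form, so that lia
   identifies them. *)
Let szM (x y : {poly F}) :
  x != 0 -> y != 0 -> size (x * y) = (size x + size y).-1 := @size_mul _ x y.
Let szZ c (x : {poly F}) : c != 0 -> size (c *: x) = size x := @size_scale _ c x.
Let szN (x : {poly F}) : size (- x) = size x := @size_polyN _ x.
Let sz_gt0 (x : {poly F}) : (0 < size x)%N = (x != 0) := size_poly_gt0 x.
Let szD (x y : {poly F}) : (size (x + y)%R <= maxn (size x) (size y))%N :=
  @size_polyD _ x y.
Let szDl (x y : {poly F}) : (size y < size x)%N -> size (x + y)%R = size x :=
  @size_polyDl _ x y.

Let pdegE (x : {poly F}) : pdeg x = (size x).-1 := erefl.

(** Descent on [size y]. With [W = S G], the product [(x - W y)(x + W y) = A + c S y^2] has degree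
    [deg S + 2 deg y], while the factors differ by [2 W y]. So the smaller factor has degree
    [deg y - deg G], which leads to a solution for the same [A] with smaller [y]. *)
Lemma small_norm_square S G A c x y :
    (2 : F) != 0 -> c != 0 -> G != 0 -> (1 < size S)%N -> (size A < size S)%N ->
    x ^+ 2 - ((S * G) ^+ 2 + c *: S) * y ^+ 2 = A ->
  exists z, [/\ A = z ^+ 2, z %| x & z %| y].
Proof.
move=> two0 c0 G0 S1 AS; have [m] := ubnP (size y).
elim: m x y => // m IH x y ym eqA.
have S0 : S != 0 by rewrite -sz_gt0; apply: leq_trans S1.
have [y0 | y0] := eqVneq y 0.
  by exists x; rewrite y0 dvdp0 dvdpp; split=> //; rewrite -eqA y0; ring.
set W := S * G in eqA *.
(* Negating [x] exchanges the two factors up to sign, so [x - W y] may be taken as the smaller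
   one. *)
wlog le_xy : x eqA / (size (x - W * y)%R <= size (x + W * y)%R)%N => [th|].
  have [l|lt] := leqP (size (x - W * y)) (size (x + W * y)); first exact: th l.
  case: (th (- x)).
  - by rewrite -eqA; ring.
  - rewrite (_ : - x - W * y = - (x + W * y)); last by ring.
    rewrite (_ : - x + W * y = - (x - W * y)); last by ring.
    by rewrite !szN ltnW.
  - by move=> z [? zx ?]; exists z; split=> //; rewrite -dvdpNr.
set z := x - W * y in le_xy; set v := x + W * y in le_xy.
have cS0 : c *: S != 0 by rewrite scaler_eq0 negb_or c0.
have szS : size (c *: S) = size S by rewrite szZ.
have szE : size (z * v) = (size S + size y + size y - 2)%N.
  have -> : z * v = A + c *: S * y ^+ 2 by rewrite -eqA /z /v; ring.
  have szy2 : size (c *: S * y ^+ 2) = (size S + size y + size y - 2)%N.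
    rewrite expr2 mulrA !szM ?mulf_neq0 // szS.
    by move: y0; rewrite -sz_gt0; lia.
  rewrite addrC szDl ?szy2 //.
  by move: y0; rewrite -sz_gt0; lia.
have szvz : size (v - z) = (size S + size G + size y - 2)%N.
  have -> : v - z = (2%:R)%:P * (S * G * y) by rewrite /v /z /W polyC_natr; ring.
  rewrite mul_polyC szZ // !szM ?mulf_neq0 //.
  by move: y0 G0 S0; rewrite -!sz_gt0; lia.
have [z0 v0] : z != 0 /\ v != 0.
  apply/andP; rewrite -negb_or -mulf_eq0 -sz_gt0 szE.
  by move: y0; rewrite -sz_gt0; lia.
have G1 : (0 < size G)%N by rewrite sz_gt0.
have y1 : (0 < size y)%N by rewrite sz_gt0.
have z1 : (0 < size z)%N by rewrite sz_gt0.
have v1 : (0 < size v)%N by rewrite sz_gt0.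
have szE' := szM _ _ z0 v0; rewrite szE in szE'.
(* With equal degrees, both factors would have degree at least [deg S + deg G + deg y], too much for
   their product. *)
have lt_zv : (size z < size v)%N.
  rewrite ltn_neqAle le_xy andbT; apply/eqP => ezv.
  have := szD v (- z); rewrite szN szvz ezv maxnn.
  by move: szE' szvz S1 G1 y1 v1; rewrite ezv; clear; lia.
have szv : size v = size (v - z) by rewrite szDl // szN.
have le_zy : (size z <= size y)%N.
  by move: szE' szv S1 G1 y1; rewrite szvz; clear; lia.
(* Up to a constant, (z - W w) + w sqrt D is (x + y sqrt D) S / (W + sqrt D)^2. *)
pose k := (2 / c) *: (G * z); pose w := y - k.
have eqk : c%:P * k = 2%:R * (G * z).
  by rewrite mul_polyC scalerA mulrC divfK // -mul_polyC polyC_natr.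
have zk : z %| k by rewrite dvdpZr ?mulf_neq0 ?invr_eq0 // dvdp_mull.
(* For fixed [z], [y] is a root of [c S Y^2 - 2 S G z Y = z^2 - A]. The other root is [-w], and this
   is the product of the roots. *)
have eqw : c *: S * (w * y) = z ^+ 2 - A.
  rewrite -eqA -mul_polyC (_ : _ * (w * y) = c%:P * S * y ^+ 2 - S * y * (c%:P * k)).
    by rewrite eqk /z /W; ring.
  by rewrite /w; ring.
have [w0 | w0] := eqVneq w 0.
  have Az : A = z ^+ 2.
    by apply/eqP; rewrite eq_sym -subr_eq0 -eqw w0; apply/eqP; ring.
  have zy : z %| y by move/eqP: w0; rewrite subr_eq0 => /eqP ->.
  exists z; split=> //.
  have -> : x = z + W * y by rewrite /z; ring.
  by rewrite dvdp_addr // dvdp_mull.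
have w1 : (0 < size w)%N by rewrite sz_gt0.
have lt_wy : (size w < size y)%N.
  have := szD (z ^+ 2) (- A).
  rewrite -eqw szN expr2 !szM ?mulf_neq0 // szS.
  by move: S1 AS y1 w1 le_zy; clear; case: leqP; lia.
case: (IH (z - W * w) w).
- by apply: leq_trans lt_wy _; rewrite -ltnS.
- apply/eqP; rewrite -subr_eq0; apply/eqP.
  transitivity (z ^+ 2 - A - c *: S * (w * (w + k))).
    rewrite -mul_polyC (_ : _ * (w * (w + k)) = c%:P * S * w ^+ 2 + S * w * (c%:P * k)).
      by rewrite eqk /W; ring.
    by ring.
  by rewrite -eqw /w; ring.
- move=> r [Ar rx rw]; exists r.
  have rz : r %| z.
    have -> : z = (z - W * w) + W * w by ring.
    by rewrite dvdp_addr // dvdp_mull.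
  have ry : r %| y.
    have -> : y = w + k by rewrite /w; ring.
    by rewrite dvdp_addr // (dvdp_trans rz).
  split=> //; have -> : x = z + W * y by rewrite /z; ring.
  by rewrite dvdp_addr // dvdp_mull.
Qed.

(** Hensel lifting: every approximation stays congruent to [b] modulo [P], so the derivative [2 b']
    remains invertible modulo [P]. *)
Lemma hensel_sqrt P D b M :
    irreducible_poly P -> ~~ (P %| 2%:R * b) -> P %| b ^+ 2 - D ->
  exists2 b', P %| b' - b & P ^+ M.+1 %| b' ^+ 2 - D.
Proof.
move=> irrP Pb PbD; elim: M => [|M [b' Pb' /dvdpP [s eqs]]].
  by exists b; rewrite ?subrr ?dvdp0 ?expr1.
have cop : coprimep P (2%:R * b').
  rewrite irreducible_poly_coprime //; apply: contraNN Pb => Pb2.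
  have -> : 2%:R * b = 2%:R * b' - 2%:R * (b' - b) by ring.
  by rewrite dvdp_sub // dvdp_mull.
case/Bezout_eq1_coprimepP: cop => -[u v] /= uv.
(* Newton step, with [v] an inverse of [2 b'] modulo [P]. *)
exists (b' - s * v * P ^+ M.+1).
  have -> : b' - s * v * P ^+ M.+1 - b = (b' - b) - s * v * P ^+ M * P.
    by rewrite exprSr; ring.
  by rewrite dvdp_sub // dvdp_mull.
have -> : (b' - s * v * P ^+ M.+1) ^+ 2 - D =
  s * P ^+ M.+1 * (1 - v * (2%:R * b')) + (s * v) ^+ 2 * P ^+ M.+1 ^+ 2.
  by rewrite mulrBr mulr1 -{1}eqs; ring.
have -> : 1 - v * (2%:R * b') = u * P by apply: (canLR (addrK _)); rewrite uv.
rewrite dvdp_add // [P ^+ M.+2]exprS.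
  have -> : s * P ^+ M.+1 * (u * P) = s * u * (P * P ^+ M.+1) by ring.
  exact: dvdp_mull (dvdpp _).
by rewrite dvdp_mull // expr2 dvdp_mul // exprS dvdp_mulr.
Qed.

(** As [b] is prime to [P], the gcd of the two multiples of [N P^i] is [P^j]; then [P^i] cancels. *)
Lemma norm_dvd_irred_exp P N b i j :
    irreducible_poly P -> ~~ (P %| b) -> (i <= j)%N ->
    N * P ^+ i %| P ^+ j * P ^+ j -> N * P ^+ i %| b * P ^+ j ->
  N %| P ^+ (j - i).
Proof.
move=> irrP Pb ij d1 d2.
have P0 : P != 0 by apply: irredp_neq0.
have cop : coprimep (P ^+ j) b.
  by rewrite coprimep_expl // irreducible_poly_coprime.
rewrite -(dvdp_mul2r _ _ (expf_neq0 i P0)) -exprD subnK //.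
case/Bezout_eq1_coprimepP: cop => -[u v] /= uv.
have -> : P ^+ j = u * (P ^+ j * P ^+ j) + v * (b * P ^+ j).
  by rewrite -[LHS]mul1r -uv; ring.
by rewrite dvdp_add // dvdp_mull.
Qed.

(** The norm has degree below [deg S], so it is a square [z^2] with [x = x' z], [y = y' z], and
    [x' + y' sqrt D] has norm 1. Hence [P] does not divide [x' - y' b], and [P^e] divides [z]. But
    [z^2] divides [P^e], which is impossible by degrees. *)
Lemma no_small_generator P S G c b x y e :
    (2 : F) != 0 -> c != 0 -> G != 0 -> irreducible_poly P -> (0 < e)%N ->
    (e * pdeg P < pdeg S)%N ->
    P %| b ^+ 2 - ((S * G) ^+ 2 + c *: S) -> P ^+ e %| x - y * b ->
    x ^+ 2 - ((S * G) ^+ 2 + c *: S) * y ^+ 2 %| P ^+ e ->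
  False.
Proof.
set D := _ + c *: S => two0 c0 G0 irrP e0 ltPS PbD Pxy Ndvd.
have P0 : P != 0 by apply: irredp_neq0.
have szP : (1 < size P)%N by case: irrP.
have szPe : size (P ^+ e) = (e * pdeg P).+1.
  by rewrite -[LHS]prednK ?sz_gt0 ?expf_neq0 // size_exp mulnC.
have ltS : ((e * pdeg P).+1 < size S)%N by move: ltPS; rewrite [pdeg S]pdegE; clear; lia.
have [||z [eqN zx zy]] := @small_norm_square S G _ c x y two0 c0 G0 _ _ erefl.
- exact: leq_ltn_trans ltS.
- by apply: leq_ltn_trans ltS; rewrite -szPe dvdp_leq ?expf_neq0.
rewrite -/D in eqN; rewrite -/D eqN in Ndvd.
have z0 : z != 0.
  by apply: contraTneq Ndvd => ->; rewrite expr0n dvd0p expf_neq0.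
move: zx zy => /dvdpP [x' ex] /dvdpP [y' ey].
have N1 : x' ^+ 2 - D * y' ^+ 2 = 1.
  apply: (mulfI (expf_neq0 2 z0)); rewrite mulr1 -[RHS]eqN ex ey; ring.
have [Pd | Pnd] := boolP (P %| x' - y' * b).
  have : P %| 1.
    rewrite -N1.
    have -> : x' ^+ 2 - D * y' ^+ 2 =
      (x' - y' * b) * (x' + y' * b) + y' ^+ 2 * (b ^+ 2 - D) by ring.
    by rewrite dvdp_add ?(dvdp_mulr _ Pd) // dvdp_mull.
  by rewrite dvdp1 (gtn_eqF szP).
have : P ^+ e %| z.
  rewrite -(Gauss_dvdpl z (_ : coprimep (P ^+ e) (x' - y' * b))).
    by have <- : x - y * b = z * (x' - y' * b) by rewrite ex ey; ring.
  by rewrite coprimep_expl // irreducible_poly_coprime.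
move=> Pz; have le1 : (size (P ^+ e) <= size z)%N := dvdp_leq z0 Pz.
have le2 : (size (z * z)%R <= size (P ^+ e))%N := dvdp_leq (expf_neq0 e P0) Ndvd.
have : (0 < e * pdeg P)%N by rewrite muln_gt0 e0 pdegE -subn1 subn_gt0.
move: le1 le2; rewrite szPe szM //; clear; lia.
Qed.
End PolynomialNorms.

(** * Fractions, the embedding of [F[T]] in [K], and integral closedness *)

Lemma frac_repr (R : idomainType) (k : {fraction R}) :
  exists n d, d != 0 /\ k * FracField.tofrac d = FracField.tofrac n.
Proof.
elim/quotW: k => x; exists (frac x).1, (frac x).2; split; first exact: denom_ratioP.
unlock FracField.tofrac; rewrite -[LHS]FracField.pi_mul.
apply/eqmodP; rewrite /= FracField.equivfE /FracField.mulf.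
by rewrite !numden_Ratio ?mulf_neq0 ?oner_neq0 ?denom_ratioP // !mulr1 mulrC.
Qed.

Section PolyEmbed.
Variables (F : fieldType) (K : fieldExtType {fraction {poly F}}).
Local Notation e := (poly_embed K).

Lemma poly_embed_is_zmod_morphism : zmod_morphism e.
Proof. by move=> x y; rewrite /poly_embed tofracB scalerBl. Qed.

Lemma poly_embed_is_monoid_morphism : monoid_morphism e.
Proof.
split=> [|x y]; first by rewrite /poly_embed tofrac1 scale1r.
by rewrite /poly_embed tofracM -scalerAl mul1r scalerA.
Qed.

HB.instance Definition _ := GRing.isZmodMorphism.Build {poly F} K e
  poly_embed_is_zmod_morphism.
HB.instance Definition _ := GRing.isMonoidMorphism.Build {poly F} K e
  poly_embed_is_monoid_morphism.

Lemma poly_embed_eq0 x : (e x == 0) = (x == 0).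
Proof. by rewrite scaler_eq0 oner_eq0 orbF tofrac_eq0. Qed.

(** Rational root argument: with the fraction in lowest terms [a' / b'], clearing denominators in a
    monic equation of degree [n] gives [b' %| a' ^+ n], so [b'] is a unit. *)
Lemma integral_quotient_dvd a b :
  b != 0 -> integralOver e (e a / e b) -> b %| a.
Proof.
move=> b0 [p mon_p rp].
set d := gcdp a b; pose a' := a %/ d; pose b' := b %/ d.
have d0 : d != 0 by rewrite gcdp_eq0 negb_and b0 orbT.
have ea : a = a' * d by rewrite divpK // dvdp_gcdl.
have eb : b = b' * d by rewrite divpK // dvdp_gcdr.
have cop : coprimep a' b' by rewrite coprimep_div_gcd // b0 orbT.
have b'0 : b' != 0 by apply: contraNneq b0 => b'0; rewrite eb b'0 mul0r.
have eq_ab : e a / e b = e a' / e b'.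
  by rewrite ea eb !rmorphM /= invfM mulrACA divff ?mulr1 // poly_embed_eq0.
have := rp; rewrite eq_ab /root => /eqP p0.
pose n := (size p).-1.
have szp : size p = n.+1 by rewrite prednK // size_poly_gt0 monic_neq0.
have sum0 : \sum_(i < n.+1) p`_i * a' ^+ i * b' ^+ (n - i) = 0.
  apply/eqP; rewrite -poly_embed_eq0 rmorph_sum /=; apply/eqP.
  rewrite (@horner_coef_wide _ n.+1) in p0; last by rewrite -szp size_poly.
  have := congr1 ( *%R (e b' ^+ n)) p0; rewrite mulr0 mulr_sumr; apply: etrans.
  apply: eq_bigr => i _; rewrite coef_map /= !rmorphM /= !rmorphXn /= expr_div_n.
  have in_ : (i <= n)%N by rewrite -ltnS.
  have -> : e b' ^+ n = e b' ^+ (n - i) * e b' ^+ i by rewrite -exprD subnK.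
  have eb0 : e b' ^+ i != 0 by rewrite expf_neq0 // poly_embed_eq0.
  by field.
have : b' %| a' ^+ n.
  have /eqP := sum0; rewrite big_ord_recr /= subnn mulr1.
  have -> : p`_n = 1 by rewrite /n -lead_coefE (monicP mon_p).
  rewrite mul1r addr_eq0 => /eqP eqs; rewrite -dvdpNr -eqs.
  apply: (big_ind (fun q => b' %| q)) => [|x y|i _]; first exact: dvdp0.
  - exact: dvdp_add.
  - by rewrite dvdp_mull // -(subnSK (ltn_ord i)) exprS dvdp_mulr.
rewrite -[_ ^+ n]mulr1 Gauss_dvdpr; last by rewrite coprimep_expr // coprimep_sym.
by move=> b1; rewrite ea eb dvdp_mul // (dvdp_trans b1) // dvd1p.
Qed.
End PolyEmbed.

(** * The ring of integers as [F[T] + F[T] sqrt D] *)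

Section QuadraticOrder.
Variables (F : fieldType) (K : fieldExtType {fraction {poly F}}).
Variables (D : {poly F}) (s : K).
Local Notation e := (poly_embed K).
Hypothesis two0 : (2 : F) != 0.
Hypothesis sqfD : squarefree_poly D.
Hypothesis s2 : s ^+ 2 = e D.
Hypothesis genK : <<1%VS; s>>%VS = fullv.
Hypothesis norm_eq0 :
  forall x y : {poly F}, x ^+ 2 - D * y ^+ 2 = 0 -> x = 0 /\ y = 0.
Implicit Types (x y g A B : {poly F}) (z : K).

Definition qelt x y : K := e x + e y * s.

Lemma qeltD x y x' y' : qelt x y + qelt x' y' = qelt (x + x') (y + y').
Proof. by rewrite /qelt !rmorphD /=; ring. Qed.

Lemma qeltN x y : - qelt x y = qelt (- x) (- y).
Proof. by rewrite /qelt !rmorphN /=; ring. Qed.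

Lemma qeltM x y x' y' :
  qelt x y * qelt x' y' = qelt (x * x' + D * y * y') (x * y' + y * x').
Proof. by rewrite /qelt !rmorphD /= !rmorphM /= -s2; ring. Qed.

Lemma qeltE x : e x = qelt x 0.
Proof. by rewrite /qelt rmorph0 mul0r addr0. Qed.

Lemma qelt_norm x y : qelt x y * qelt x (- y) = e (x ^+ 2 - D * y ^+ 2).
Proof. by rewrite qeltM qeltE; congr qelt; ring. Qed.

Lemma qelt_eq0 x y : qelt x y = 0 -> x = 0 /\ y = 0.
Proof.
move=> q0; apply: norm_eq0; apply/eqP.
have : e (x ^+ 2 - D * y ^+ 2) == 0 by rewrite -qelt_norm q0 mul0r.
by rewrite poly_embed_eq0.
Qed.

Lemma qelt_inj x y x' y' : qelt x y = qelt x' y' -> x = x' /\ y = y'.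
Proof.
move/eqP; rewrite -subr_eq0 qeltN qeltD => /eqP /qelt_eq0 [/eqP + /eqP].
by rewrite !subr_eq0 => /eqP -> /eqP ->.
Qed.

(** The elements of this shape are closed under sums and products and contain the base field and
    [s], which generates [K]. *)
Lemma qelt_fracP z : exists x y g, g != 0 /\ z * e g = qelt x y.
Proof.
pose Q z := exists x y g, g != 0 /\ z * e g = qelt x y.
have QD z1 z2 : Q z1 -> Q z2 -> Q (z1 + z2).
  move=> [x1 [y1 [g1 [g10 e1]]]] [x2 [y2 [g2 [g20 e2]]]].
  exists (x1 * g2 + x2 * g1), (y1 * g2 + y2 * g1), (g1 * g2).
  rewrite mulf_neq0 //; split=> //; rewrite -qeltD rmorphM /= mulrDl.
  by rewrite mulrA e1 mulrCA e2 !qeltE !qeltM; congr (_ + _); congr qelt; ring.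
have QM z1 z2 : Q z1 -> Q z2 -> Q (z1 * z2).
  move=> [x1 [y1 [g1 [g10 e1]]]] [x2 [y2 [g2 [g20 e2]]]].
  exists (x1 * x2 + D * y1 * y2), (x1 * y2 + y1 * x2), (g1 * g2).
  by rewrite mulf_neq0 //; split=> //; rewrite -qeltM rmorphM /= mulrACA e1 e2.
have Q0 : Q 0 by exists 0, 0, 1; rewrite oner_neq0 mul0r -qeltE rmorph0.
have Qs : Q s.
  by exists 0, 1, 1; rewrite oner_neq0 /qelt rmorph1 rmorph0; split=> //; ring.
have Qk k : Q k%:A.
  have [n [d [d0 eqk]]] := frac_repr _ k.
  exists n, 0, d; split=> //; rewrite -qeltE /poly_embed.
  by rewrite -scalerAl mul1r scalerA eqk.
have: z \in <<1; s>>%VS by rewrite genK memvf.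
case/Fadjoin_polyP => p Kp ->; rewrite -/(Q _) horner_coef.
apply: (big_ind Q) => // i _; apply: (QM).
  by have /vlineP [k ->] := polyOverP Kp i.
elim: (i : nat) => [|j IHj]; last by rewrite exprS; apply: QM.
by rewrite expr0 -[1]scale1r; apply: Qk.
Qed.

(** This replaces the automorphism [s -> -s]: by induction on [p], the values of [p] at [z] and at
    its conjugate are conjugate, so they vanish together. *)
Lemma conj_horner (p : {poly {poly F}}) z x y g :
    g != 0 -> z * e g = qelt x y ->
  root (map_poly e p) z -> root (map_poly e p) (qelt x (- y) / e g).
Proof.
set z' := _ / _ => g0 ez.
have eg0 : e g != 0 by rewrite poly_embed_eq0.
have ez' : z' * e g = qelt x (- y) by rewrite divfK.
clearbody z'.
have [A [B [h [h0 e1 e2]]]] : exists A B h, [/\ h != 0,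
    (map_poly e p).[z] * e h = qelt A B & (map_poly e p).[z'] * e h = qelt A (- B)].
  elim/poly_ind: p => [|p c [A [B [h [h0 e1 e2]]]]].
    exists 0, 0, 1; rewrite oner_neq0 map_poly0 !horner0 !mul0r oppr0.
    by rewrite -qeltE rmorph0.
  exists (A * x + D * B * y + c * h * g), (A * y + B * x), (h * g).
  rewrite mulf_neq0 // rmorphD rmorphM /= map_polyX map_polyC /= !hornerE.
  split=> //.
    rewrite -[A * y + _]addr0 -qeltD -qeltM -e1 -ez -qeltE !rmorphM /=; ring.
  rewrite (_ : - (A * y + B * x) = (A * - y + - B * x) + 0); last by ring.
  rewrite (_ : D * B * y = D * (- B) * (- y)); last by ring.
  by rewrite -qeltD -qeltM -e2 -ez' -qeltE !rmorphM /=; ring.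
rewrite /root => /eqP p0; move: e1; rewrite p0 mul0r => /esym /qelt_eq0 [A0 B0].
move: e2; rewrite A0 B0 oppr0 -qeltE rmorph0 => /eqP.
by rewrite mulf_eq0 poly_embed_eq0 (negPf h0) orbF.
Qed.

(** For an integral [z = (x + y s) / g], the trace [2 x / g] and the norm are integral fractions,
    hence polynomials. As 2 is invertible, [g] divides [x]; then [g^2] divides [D y^2], and [g]
    divides [y] because [D] is square-free. *)
Lemma ring_of_integersP z : ring_of_integers z <-> exists x y, z = qelt x y.
Proof.
split; last first.
  move=> [x [y ->]]; rewrite /ring_of_integers /=.
  apply: integral_add; first exact: integral_id.
  apply: integral_mul; first exact: integral_id.
  exists ('X^2 - D%:P); first by rewrite monicXnsubC.
  by rewrite rmorphB /= map_polyXn map_polyC /root !hornerE s2 subrr.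
move=> iz; have [x [y [g [g0 ez]]]] := qelt_fracP z.
have eg0 : e g != 0 by rewrite poly_embed_eq0.
have iz' : integralOver e (qelt x (- y) / e g).
  by case: iz => p mp rp; exists p => //; apply: conj_horner rp.
have zE : z = qelt x y / e g by rewrite -ez mulfK.
have gx : g %| x.
  have : g %| 2%:R * x.
    apply: (@integral_quotient_dvd F K) g0 _.
    have -> : e (2%:R * x) / e g = z + qelt x (- y) / e g.
      by rewrite zE -mulrDl qeltD addrN -qeltE; congr (e _ / _); ring.
    exact: integral_add.
  by rewrite -polyC_natr mul_polyC dvdpZr.
have gN : g ^+ 2 %| x ^+ 2 - D * y ^+ 2.
  apply: (@integral_quotient_dvd F K); first by rewrite expf_neq0.
  have -> : e (x ^+ 2 - D * y ^+ 2) / e (g ^+ 2) = z * (qelt x (- y) / e g).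
    by rewrite zE mulrACA qelt_norm -invfM -rmorphM /= expr2.
  exact: integral_mul.
have gy : g %| y.
  have : g ^+ 2 %| D * y ^+ 2.
    have -> : D * y ^+ 2 = x ^+ 2 - (x ^+ 2 - D * y ^+ 2) by ring.
    by rewrite dvdp_sub // dvdp_exp2r.
  set d := gcdp g y; pose g' := g %/ d; pose y' := y %/ d.
  have d0 : d != 0 by rewrite gcdp_eq0 negb_and g0.
  have eg : g = g' * d by rewrite divpK // dvdp_gcdl.
  have ey : y = y' * d by rewrite divpK // dvdp_gcdr.
  have cop : coprimep g' y' by rewrite coprimep_div_gcd // g0.
  rewrite {1}eg {1}ey !exprMn [D * _]mulrA dvdp_mul2r ?expf_neq0 //.
  rewrite Gauss_dvdpl ?coprimep_expl ?coprimep_expr // => g2D.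
  have : size g' = 1%N by apply/eqP; apply: contraLR g2D; apply: sqfD.
  by move/eqP; rewrite -dvdp1 => g1; rewrite eg ey dvdp_mul // (dvdp_trans g1) // dvd1p.
case/dvdpP: gx => x' ex; case/dvdpP: gy => y' ey; exists x', y'.
rewrite zE ex ey; apply: (mulIf eg0); rewrite divfK // [e g]qeltE qeltM.
by congr qelt; ring.
Qed.
End QuadraticOrder.

Arguments qelt {F K} s x y.

(** * Ideal classes as orbits under scaling *)

Section IdealClasses.
Local Open Scope classical_set_scope.
Variables (F : fieldType) (K : fieldExtType {fraction {poly F}}).
Implicit Types (I J : set K) (x y z : K).
Local Notation O := (@ring_of_integers F K).

Definition ideal_module I : Prop :=
  [/\ I 0, forall x y, I x -> I y -> I (x + y)
    & forall a x, O a -> I x -> I (a * x)].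

Lemma fractional_ideal_module I : fractional_ideal I -> ideal_module I.
Proof. by case. Qed.

Definition scale_ideal x I : set K := [set x * a | a in I].

Lemma scale_idealM x y I : scale_ideal x (scale_ideal y I) = scale_ideal (x * y) I.
Proof.
apply/seteqP; split=> z /=.
  by move=> [_ [a Ia <-] <-]; exists a; rewrite ?mulrA.
by move=> [a Ia <-]; exists (y * a); rewrite ?mulrA //; exists a.
Qed.

Lemma scale_ideal1 I : scale_ideal 1 I = I.
Proof.
apply/seteqP; split=> z /=; first by move=> [a Ia <-]; rewrite mul1r.
by exists z; rewrite ?mul1r.
Qed.

Lemma scale_ideal_module x I : ideal_module I -> ideal_module (scale_ideal x I).
Proof.
case=> I0 ID IM; split.
- by exists 0; rewrite ?mulr0.
- by move=> _ _ [a Ia <-] [b Ib <-]; exists (a + b); rewrite ?mulrDr //; apply: ID.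
- by move=> a _ Oa [b Ib <-]; exists (a * b); [apply: IM | rewrite mulrCA].
Qed.

Lemma ideal_mul_principal I x :
  ideal_module I -> ideal_mul I (principal_ideal x) = scale_ideal x I.
Proof.
case=> I0 ID IM; apply/seteqP; split=> z /=.
  move=> [n [u [v [Iu pv ->]]]].
  apply: (big_ind (scale_ideal x I)) => [|_ _ [a Ia <-] [b Ib <-]|i _].
  - by exists 0; rewrite ?mulr0.
  - by exists (a + b); rewrite ?mulrDr //; apply: ID.
  - have [o Oo <-] := pv i; exists (o * u i); first exact: IM.
    by rewrite [o * _]mulrC mulrCA.
move=> [a Ia <-]; exists 1%N, (fun=> a), (fun=> x); split=> //.
  by move=> _; exists 1; [apply: integral1 | rewrite mulr1].
by rewrite big_ord1 mulrC.
Qed.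

(** From here on, comparing classes means finding a scaling factor in [K], with no products of
    ideals. *)
Lemma ideal_classE I : ideal_module I ->
  ideal_class I = [set scale_ideal x I | x in [set x | x != 0]].
Proof.
move=> mI; apply/seteqP; split=> J /=.
  by move=> [_ [x x0 <-] <-]; exists x; rewrite ?ideal_mul_principal.
move=> [x x0 <-]; exists (principal_ideal x); last exact: ideal_mul_principal.
by exists x.
Qed.

Lemma ideal_class_scale I x :
  x != 0 -> ideal_module I -> ideal_class (scale_ideal x I) = ideal_class I.
Proof.
move=> x0 mI; rewrite !ideal_classE //; last exact: scale_ideal_module.
apply/seteqP; split=> J /=; move=> [y y0 <-].
  by exists (y * x); rewrite /= ?mulf_neq0 // scale_idealM.
by exists (y / x); rewrite /= ?mulf_neq0 ?invr_eq0 // scale_idealM divfK.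
Qed.

Lemma ideal_class_eq I J : ideal_module I -> ideal_module J ->
  ideal_class I = ideal_class J -> exists2 x, x != 0 & scale_ideal x I = J.
Proof.
move=> mI mJ eqIJ.
have : ideal_class J J.
  by rewrite ideal_classE //; exists 1; rewrite /= ?oner_neq0 // scale_ideal1.
by rewrite -eqIJ ideal_classE // => -[x x0 <-]; exists x.
Qed.
End IdealClasses.

Arguments ideal_module {F K} I.
Arguments scale_ideal {F K} x I.

(** * Simultaneous approximation of fractions by linear algebra *)

Section Approximation.
Variable F : fieldType.
Implicit Types U V G : {poly F}.

(* Pigeonhole for the 2d leading coefficients of the fractional parts of
   tU/G and tV/G; if deg G < d, truncated subtraction only repeats some of the
   conditions. *)
Lemma simultaneous_approximation U V G d : G != 0 ->
  exists t : 'rV[F]_(d + d).+1, [/\ t != 0,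
    (size ((rVpoly t * U) %% G)%R <= (size G).-1 - d)%N &
    (size ((rVpoly t * V) %% G)%R <= (size G).-1 - d)%N].
Proof.
move=> G0; pose n := (size G).-1.
pose M W : 'M[F]_((d + d).+1, d) := \matrix_(i, k) (('X^i * W) %% G)`_(n - k.+1).
have MW W (t : 'rV[F]_(d + d).+1) :
    t *m M W = 0 -> (size ((rVpoly t * W) %% G)%R <= n - d)%N.
  move=> /rowP tM0.
  have coef_t k : (k < d)%N -> ((rVpoly t * W) %% G)`_(n - k.+1) = 0.
    move=> kd; have := tM0 (Ordinal kd); rewrite !mxE; apply: etrans.
    have -> : rVpoly t * W = \sum_i t 0 i *: ('X^i * W).
      rewrite /rVpoly poly_def mulr_suml; apply: eq_bigr => i _.
      by rewrite valK -scalerAl.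
    have -> : (\sum_i t 0 i *: ('X^i * W)) %% G = \sum_i (t 0 i *: ('X^i * W)) %% G.
      by apply: (big_morph (fun q => q %% G)) => [q r|]; rewrite ?modpD ?mod0p.
    rewrite coef_sum.
    by apply: eq_bigr => i _; rewrite modpZl coefZ mxE.
  have szr : (size ((rVpoly t * W) %% G)%R <= n)%N.
    by rewrite -ltnS prednK ?size_poly_gt0 // ltn_modp.
  apply/leq_sizeP => j dj; have [nj|jn] := leqP n j.
    by move/leq_sizeP: szr; apply.
  by have := coef_t (n - j.+1)%N; rewrite subnSK // subKn ?(ltnW jn) //; apply; lia.
pose Mx := row_mx (M U) (M V).
(* There are [(d + d).+1] rows but only [d + d] columns. *)
have : kermx Mx != 0.
  rewrite kermx_eq0 /row_free; apply: contraTneq (rank_leq_col Mx) => ->.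
  by rewrite -ltnNge.
case/rowV0Pn => t /sub_kermxP tM t0; exists t.
by move: tM; rewrite mul_mx_row -row_mx0 => /eq_row_mx [tU tV]; split=> //; apply: MW.
Qed.
End Approximation.

(** * Finiteness of the class group *)

Section ClassGroupFinite.
Local Open Scope classical_set_scope.
Variables (F : finFieldType) (K : fieldExtType {fraction {poly F}}).
Variables (D : {poly F}) (s : K).
Local Notation e := (poly_embed K).
Hypothesis s2 : s ^+ 2 = e D.
Hypothesis norm_eq0 :
  forall x y : {poly F}, x ^+ 2 - D * y ^+ 2 = 0 -> x = 0 /\ y = 0.
Hypothesis intP : forall z : K, ring_of_integers z <-> exists x y, z = qelt s x y.
Implicit Types (I J : set K).

Let O_embed x : ring_of_integers (e x).
Proof. by apply/intP; exists x, 0; rewrite (qeltE _ _ s). Qed.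

Lemma module_opp I z : ideal_module I -> I z -> I (- z).
Proof.
case=> _ _ IM Iz; rewrite -mulN1r; apply: IM => //.
by rewrite -(rmorph1 e) -rmorphN; apply: O_embed.
Qed.

(* Minimality of the norm of x in I makes I commensurable with xO, with a
   multiplier t of bounded degree. *)
Lemma minimal_norm_multiple I x1 x2 z :
    ideal_module I -> (forall z, I z -> ring_of_integers z) ->
    I (qelt s x1 x2) -> qelt s x1 x2 != 0 ->
    (forall w1 w2, I (qelt s w1 w2) -> qelt s w1 w2 != 0 ->
       (size (x1 ^+ 2 - D * x2 ^+ 2)%R <= size (w1 ^+ 2 - D * w2 ^+ 2)%R)%N) ->
    I z ->
  exists t : 'rV[F]_(size D + size D).+1, exists2 o,
    t != 0 & ring_of_integers o /\ e (rVpoly t) * z = qelt s x1 x2 * o.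
Proof.
move=> mI IO Ix x0 minx Iz.
have [z1 [z2 ez]] : exists z1 z2, z = qelt s z1 z2 by apply/intP; apply: IO.
(* Multiplying by the conjugate of [x = x1 + x2 s] gives [z / x = (U + V s) / G]. *)
pose G := x1 ^+ 2 - D * x2 ^+ 2; pose U := z1 * x1 - D * z2 * x2.
pose V := z2 * x1 - z1 * x2; pose d := size D; pose n := (size G).-1.
have G0 : G != 0.
  apply: contraNneq x0 => /norm_eq0 [-> ->].
  by rewrite -(qeltE _ _ s) rmorph0.
have [t [t0 tU tV]] := simultaneous_approximation F U V G d G0.
set T := rVpoly t in tU tV; pose a := (T * U) %/ G; pose b := (T * V) %/ G.
(* [a + b s] is the polynomial part of [T z / x], and [w1 + w2 s] is the remainder
   [T z - x (a + b s)], which has to vanish. *)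
pose w1 := T * z1 - (a * x1 + D * b * x2); pose w2 := T * z2 - (a * x2 + b * x1).
have eqw : e T * z = qelt s x1 x2 * qelt s a b + qelt s w1 w2.
  rewrite ez (qeltE _ _ s) (qeltM _ _ _ _ s2) (qeltM _ _ _ _ s2) qeltD.
  by congr qelt; rewrite /w1 /w2; ring.
exists t, (qelt s a b) => //; split; first by apply/intP; exists a, b.
rewrite eqw -[RHS]addr0; congr (_ + _); apply/eqP; apply: contraT => w0.
have Iw : I (qelt s w1 w2).
  have -> : qelt s w1 w2 = e T * z + - (qelt s a b * qelt s x1 x2).
    by rewrite eqw mulrC; ring.
  have [_ ID IM] := mI; apply: (ID); first exact: IM.
  by apply: module_opp => //; apply: IM => //; apply/intP; exists a, b.
have le_w := minx _ _ Iw w0.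
pose f := T * U %% G; pose g := T * V %% G.
(* If the remainder is nonzero, minimality makes the left side of degree at least [2 n]. The right
   side is smaller: [f] and [g] have size at most [n - d], and [d = size D] absorbs the factor
   [D]. *)
have eqN : (w1 ^+ 2 - D * w2 ^+ 2) * G = f ^+ 2 - D * g ^+ 2.
  have -> : f = T * U - a * G.
    by apply: (canRL (addrK _)); rewrite addrC -divp_eq.
  have -> : g = T * V - b * G.
    by apply: (canRL (addrK _)); rewrite addrC -divp_eq.
  by rewrite /G /U /V /w1 /w2; ring.
have Nw0 : w1 ^+ 2 - D * w2 ^+ 2 != 0.
  by apply: contraNneq w0 => /norm_eq0 [-> ->]; rewrite -(qeltE _ _ s) rmorph0.
have szG : size G = n.+1 by rewrite prednK // size_poly_gt0.
have szNG : size ((w1 ^+ 2 - D * w2 ^+ 2) * G) = (size (w1 ^+ 2 - D * w2 ^+ 2)%R + n)%N.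
  by rewrite size_mul // szG addnS.
have szf2 : (size (f * f)%R <= (size f + size f).-1)%N := size_polyMleq f f.
have szg2 : (size (g * g)%R <= (size g + size g).-1)%N := size_polyMleq g g.
have szDg : (size (D * (g * g))%R <= (d + size (g * g)%R).-1)%N := size_polyMleq D _.
(* For [g = 0] the bound [szDg] gives only [d.-1]. *)
have szDg0 : size g = 0%N -> size (D * (g * g)) = 0%N.
  by move/eqP; rewrite size_poly_eq0 => /eqP ->; rewrite !mulr0 size_poly0.
have szfg : (size (f * f - D * (g * g))%R
    <= maxn (size (f * f)%R) (size (D * (g * g))%R))%N.
  by rewrite -(size_polyN (D * _)); apply: size_polyD.
have eqs : size (f * f - D * (g * g)) = (size (w1 ^+ 2 - D * w2 ^+ 2)%R + n)%N.
  by rewrite -szNG eqN !expr2.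
rewrite -/f -/n in tU; rewrite -/g -/n in tV.
move: le_w Nw0; rewrite -/G szG -size_poly_gt0 => le_w Nw_gt0.
by move: tU tV le_w Nw_gt0 szf2 szg2 szDg szDg0 szfg; rewrite eqs; clear; case: leqP; lia.
Qed.
(** A common multiple of all the multipliers from [minimal_norm_multiple]. It is a finite product
    because [F] is finite, and it depends only on [D]. *)
Let tau := \prod_(t : 'rV[F]_(size D + size D).+1 | t != 0) rVpoly t.

Let tau_neq0 : tau != 0.
Proof.
apply/prodf_neq0 => t; apply: contraNneq => rt0.
by rewrite -(rVpolyK t) rt0 linear0.
Qed.

(** Scale [I] into the ring of integers, choose there a nonzero [x] with norm of least degree, and
    scale by [tau / x]. The result is integral because a factor of [tau] carries each element into
    the multiples of [x]; it contains [tau] as the image of [x]. *)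
Lemma class_representative I : fractional_ideal I ->
  exists J, [/\ ideal_module J, ideal_class J = ideal_class I,
    forall z, J z -> ring_of_integers z & J (e tau)].
Proof.
move=> fI; have mI := fractional_ideal_module _ _ _ fI.
case: fI => _ _ _ [y0 Iy0 y00] [a [Oa a0 aI]].
pose I' := scale_ideal a I; have mI' : ideal_module I' by apply: scale_ideal_module.
have I'O z : I' z -> ring_of_integers z by move=> [y Iy <-]; apply: aI.
pose Q n := exists x1 x2, [/\ I' (qelt s x1 x2), qelt s x1 x2 != 0 &
  size (x1 ^+ 2 - D * x2 ^+ 2) = n].
have exQ : exists n, `[< Q n >].
  have [x1 [x2 ex]] : exists x1 x2, a * y0 = qelt s x1 x2 by apply/intP/aI.
  exists (size (x1 ^+ 2 - D * x2 ^+ 2)); apply/asboolP; exists x1, x2.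
  by rewrite -ex mulf_neq0 //; split=> //; exists y0.
case: (ex_minnP exQ) => m /asboolP [x1 [x2 [Ix x0 szm]]] minm.
set x := qelt s x1 x2 in Ix x0.
have et0 : e tau != 0 by rewrite poly_embed_eq0.
exists (scale_ideal (e tau / x) I'); split.
- exact: scale_ideal_module.
- by rewrite !ideal_class_scale // mulf_neq0 ?invr_eq0.
- move=> _ [z Iz <-].
  have [|t [o t0 [Oo eo]]] := minimal_norm_multiple _ x1 x2 z mI' I'O Ix x0 _ Iz.
    by move=> w1 w2 Iw w0; rewrite szm; apply: minm; apply/asboolP; exists w1, w2.
  have -> : e tau / x * z = e (\prod_(t' : 'rV[F]_(size D + size D).+1 |
      (t' != 0) && (t' != t)) rVpoly t') * o.
    rewrite /tau (bigD1 t) //= rmorphM /=; apply: (mulfI x0).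
    by rewrite [RHS]mulrCA -eo; field.
  have [u [v ->]] : exists u v, o = qelt s u v by apply/intP.
  by apply/intP; rewrite (qeltE _ _ s) (qeltM _ _ _ _ s2); do 2!eexists.
- by exists x => //; rewrite divfK.
Qed.

(** Unions of residue classes modulo [tau]. Coding residues as row vectors makes the index [A] range
    over a finite type. *)
Let residue_set (A : {set 'rV[F]_(size tau) * 'rV[F]_(size tau)}) : set K :=
  [set z | exists x y, z = qelt s x y /\
     (poly_rV (x %% tau), poly_rV (y %% tau)) \in A].

(** Containing [tau], [J] contains all its integral multiples, so membership depends only on the
    coordinates modulo [tau]. *)
Lemma residue_setP J :
    ideal_module J -> (forall z, J z -> ring_of_integers z) -> J (e tau) ->
  exists A, J = residue_set A.
Proof.
move=> mJ JO Jt; exists [set p | `[< J (qelt s (rVpoly p.1) (rVpoly p.2)) >]]%SET.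
have JN := module_opp J _ mJ; have [_ JD JM] := mJ.
have szm (x : {poly F}) : (size (x %% tau)%R <= size tau)%N.
  by rewrite ltnW // ltn_modp.
have Jdiv x y : J (qelt s (tau * x) (tau * y)).
  have -> : qelt s (tau * x) (tau * y) = qelt s x y * e tau.
    rewrite (qeltE _ _ s) (qeltM _ _ _ _ s2).
    by congr qelt; ring.
  by apply: JM => //; apply/intP; exists x, y.
have split_mod x y : qelt s x y = qelt s (tau * (x %/ tau)) (tau * (y %/ tau))
    + qelt s (x %% tau) (y %% tau).
  by rewrite qeltD ![tau * _]mulrC -!divp_eq.
apply/seteqP; split=> z /=.
  move=> Jz; have [x [y ez]] : exists x y, z = qelt s x y by apply/intP/JO.
  exists x, y; split=> //; rewrite inE /= !poly_rV_K //; apply/asboolP.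
  rewrite -[qelt _ _ _](addKr (qelt s (tau * (x %/ tau)) (tau * (y %/ tau)))).
  by rewrite -split_mod -ez; apply: JD => //; apply: JN.
move=> [x [y [-> ]]]; rewrite inE /= !poly_rV_K // => /asboolP Jr.
by rewrite split_mod; apply: JD.
Qed.

Lemma ideal_class_group_finite : finite_set (@ideal_class_group F K).
Proof.
apply: (@sub_finite_set _ _ [set ideal_class (residue_set A) | A in setT]).
  move=> _ [I fI <-]; have [J [mJ eqJ JO Jt]] := class_representative _ fI.
  have [A eqA] := residue_setP _ mJ JO Jt.
  by exists A => //; rewrite -eqJ -eqA.
exact/finite_image/finite_finset.
Qed.
End ClassGroupFinite.

(** * The ideals above powers of [P] and their classes *)

Section PrimePowerIdeals.
Local Open Scope classical_set_scope.
Variables (F : fieldType) (K : fieldExtType {fraction {poly F}}).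
Variables (D : {poly F}) (s : K).
Local Notation e := (poly_embed K).
Hypothesis two0 : (2 : F) != 0.
Hypothesis s2 : s ^+ 2 = e D.
Hypothesis norm_eq0 :
  forall x y : {poly F}, x ^+ 2 - D * y ^+ 2 = 0 -> x = 0 /\ y = 0.
Hypothesis intP : forall z : K, ring_of_integers z <-> exists x y, z = qelt s x y.
Variables (P b : {poly F}) (M : nat).
Hypothesis irrP : irreducible_poly P.
Hypothesis Pb : ~~ (P %| b).
Hypothesis PM : P ^+ M %| b ^+ 2 - D.

(** For [i <= M], this is the kernel of the ring map onto [F[T] / (P^i)] that sends [s] to [-b]. *)
Definition prime_power_ideal i : set K :=
  [set z | exists x y, z = qelt s x y /\ P ^+ i %| x - y * b].

Let P0 : P != 0. Proof. exact: irredp_neq0. Qed.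

Let inj := qelt_inj _ _ _ _ s2 norm_eq0.

Let PiD i : (i <= M)%N -> P ^+ i %| b ^+ 2 - D.
Proof. by move=> iM; apply: dvdp_trans PM; apply: dvdp_exp2l. Qed.

Lemma prime_power_fractional i :
  (i <= M)%N -> fractional_ideal (prime_power_ideal i).
Proof.
move=> iM; split.
- by exists 0, 0; rewrite -qeltE rmorph0 mul0r subrr dvdp0.
- move=> _ _ [x [y [-> d]]] [x' [y' [-> d']]]; exists (x + x'), (y + y').
  rewrite qeltD; split=> //.
  have -> : x + x' - (y + y') * b = (x - y * b) + (x' - y' * b) by ring.
  exact: dvdp_add.
- move=> _ _ /intP [u [v ->]] [x [y [-> d]]].
  rewrite (qeltM _ _ _ _ s2); do 2!eexists; split; first by [].
  have -> : u * x + D * v * y - (u * y + v * x) * b =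
    (u - v * b) * (x - y * b) - v * y * (b ^+ 2 - D) by ring.
  by rewrite dvdp_sub // dvdp_mull // PiD.
- exists (e (P ^+ i)); last by rewrite poly_embed_eq0 expf_neq0.
  by exists (P ^+ i), 0; rewrite -qeltE mul0r subr0.
- exists 1; rewrite oner_neq0; split=> //; first exact: integral1.
  by move=> _ [x [y [-> _]]]; rewrite mul1r; apply/intP; exists x, y.
Qed.

(** Test [z] on [P^i] and on [b + s], which lies in every [prime_power_ideal]. With
    [z P^i = u + v s], the first gives [P^j] dividing [u - v b], the second [P^i] dividing
    [u + v b]. As 2 and [b] are prime to [P], [P^i] divides both [u] and [v]. *)
Lemma prime_power_multiplier i j z : (i <= j)%N ->
    (forall w, prime_power_ideal i w -> prime_power_ideal j (z * w)) ->
  exists x y, z = qelt s x y /\ P ^+ (j - i) %| x - y * b.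
Proof.
move=> ij zI; have Pi0 : P ^+ i != 0 by rewrite expf_neq0.
have cop : coprimep (P ^+ i) b by rewrite coprimep_expl // irreducible_poly_coprime.
have [|u [v [euv /dvdpP [w ew]]]] := zI (qelt s (P ^+ i) 0).
  by exists (P ^+ i), 0; rewrite mul0r subr0.
have [|u' [v' [euv' _]]] := zI (qelt s b 1).
  by exists b, 1; rewrite mul1r subrr dvdp0.
(* Both sides are the coordinates of [P^i z (b + s)]. *)
have [e1 e2] : u * b + D * v * 1 = P ^+ i * u' + D * 0 * v' /\
               u * 1 + v * b = P ^+ i * v' + 0 * u'.
  apply: inj; rewrite -!(qeltM _ _ _ _ s2) -euv -euv'; ring.
have Pij : P ^+ j = P ^+ (j - i) * P ^+ i by rewrite -exprD subnK.
have Pu : P ^+ i %| u.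
  have : P ^+ i %| (2%:R)%:P * u.
    have -> : (2%:R)%:P * u = (u * 1 + v * b) + (u - v * b).
      by rewrite polyC_natr; ring.
    rewrite e2 mul0r addr0 ew Pij mulrA.
    exact: dvdp_add (dvdp_mulr _ (dvdpp _)) (dvdp_mull _ (dvdpp _)).
  by rewrite mul_polyC dvdpZr.
have Pv : P ^+ i %| v.
  rewrite -(Gauss_dvdpl v cop).
  have -> : v * b = (u * 1 + v * b) - u by ring.
  by rewrite e2 mul0r addr0 dvdp_sub ?dvdp_mulr.
case/dvdpP: Pu => x ex; case/dvdpP: Pv => y ey; exists x, y; split.
  apply: (@mulIf _ (qelt s (P ^+ i) 0)).
    by rewrite -qeltE poly_embed_eq0.
  by rewrite euv (qeltM _ _ _ _ s2) ex ey; congr qelt; ring.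
rewrite -(dvdp_mul2r _ _ Pi0) -Pij.
have -> : (x - y * b) * P ^+ i = u - v * b by rewrite ex ey; ring.
by rewrite ew dvdp_mull.
Qed.

(** Norms from the ideal of index [i] are divisible by [P^i], so norms from that of index [j] are
    divisible by [N P^i]. Applied to [P^j], [b + s] and their sum, this yields the divisibilities of
    [norm_dvd_irred_exp], the second from the cross term [2 b P^j]. *)
Lemma prime_power_generator i j x y : (i <= j <= M)%N ->
    scale_ideal (qelt s x y) (prime_power_ideal i) = prime_power_ideal j ->
  x ^+ 2 - D * y ^+ 2 %| P ^+ (j - i).
Proof.
case/andP=> ij jM eqI; set N := _ - _.
have dvdN u v : P ^+ j %| u - v * b -> N * P ^+ i %| u ^+ 2 - D * v ^+ 2.
  move=> d; have : prime_power_ideal j (qelt s u v) by exists u, v.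
  rewrite -eqI => -[_ [x' [y' [-> d']]]]; rewrite (qeltM _ _ _ _ s2) => /inj [<- <-].
  have -> : (x * x' + D * y * y') ^+ 2 - D * (x * y' + y * x') ^+ 2 =
    N * (x' ^+ 2 - D * y' ^+ 2) by rewrite /N; ring.
  rewrite dvdp_mul //.
  rewrite (_ : _ - _ = (x' - y' * b) * (x' + y' * b) + y' ^+ 2 * (b ^+ 2 - D)).
    by rewrite dvdp_add ?(dvdp_mulr _ d') // dvdp_mull // PiD // (leq_trans ij).
  by ring.
have d1 : N * P ^+ i %| P ^+ j * P ^+ j.
  have -> : P ^+ j * P ^+ j = (P ^+ j) ^+ 2 - D * 0 ^+ 2 by ring.
  by apply: dvdN; rewrite mul0r subr0.
have d2 : N * P ^+ i %| b ^+ 2 - D.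
  have -> : b ^+ 2 - D = b ^+ 2 - D * 1 ^+ 2 by ring.
  by apply: dvdN; rewrite mul1r subrr dvdp0.
have d3 : N * P ^+ i %| (P ^+ j + b) ^+ 2 - D * 1 ^+ 2.
  by apply: dvdN; rewrite mul1r addrK.
apply: (norm_dvd_irred_exp _ P N b i j irrP Pb ij d1).
have : N * P ^+ i %| (2%:R)%:P * (b * P ^+ j).
  have -> : (2%:R)%:P * (b * P ^+ j) =
    ((P ^+ j + b) ^+ 2 - D * 1 ^+ 2) - P ^+ j * P ^+ j - (b ^+ 2 - D).
    by rewrite polyC_natr; ring.
  exact: dvdp_sub (dvdp_sub d3 d1) d2.
by rewrite mul_polyC dvdpZr.
Qed.

Lemma prime_power_class_neq S G c i j :
    D = (S * G) ^+ 2 + c *: S -> c != 0 -> G != 0 ->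
    (i < j <= M)%N -> ((j - i) * pdeg P < pdeg S)%N ->
  ideal_class (prime_power_ideal i) <> ideal_class (prime_power_ideal j).
Proof.
move=> eqD c0 G0 /andP [ij jM] ltS.
have iM : (i <= M)%N by apply: leq_trans jM; apply: ltnW.
case/ideal_class_eq.
- exact/fractional_ideal_module/prime_power_fractional.
- exact/fractional_ideal_module/prime_power_fractional.
move=> z _ eqI.
(* A priori the scaling factor [z] is only an element of [K]; this makes it integral and in the
   ideal of index [j - i]. *)
have [|w Iw|x [y [ez d]]] := prime_power_multiplier i j z.
- exact: ltnW.
- by rewrite -eqI; exists w.
have ND : x ^+ 2 - D * y ^+ 2 %| P ^+ (j - i).
  by apply: prime_power_generator; rewrite -?ez // jM ltnW.
have PD : P %| b ^+ 2 - D.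
  by rewrite -[P]expr1; apply: PiD; apply: leq_trans jM; apply: leq_ltn_trans ij.
rewrite eqD in ND PD.
by apply: no_small_generator d ND; rewrite ?subn_gt0.
Qed.
End PrimePowerIdeals.

(** * The lower bound for the class number *)

Theorem corollary2
  (p n : nat) (hp : prime p) (hodd : odd p) (hn : (0 < n)%N)
  (F : finFieldType) (hF : #|F| = (p ^ n)%N)
  (P S H D : {poly F}) (c : F)
  (hP : irreducible_poly P)
  (hc : c != 0)
  (hH : H != 0)
  (hdeg : (pdeg P < pdeg S)%N)
  (hD : D = (S * H * P) ^+ 2 + c *: S)
  (hsqf : squarefree_poly D)
  (hmonic : D \is monic)
  (K : fieldExtType {fraction {poly F}})
  (sqrtD : K)
  (hsqrtD : sqrtD ^+ 2 = poly_embed K D)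
  (hK : <<1%VS; sqrtD>>%VS = fullv)
  (hres : qr_symbol (c *: S) P = 1) :
  (pdeg S)%:R / (pdeg P)%:R <= (class_number K)%:R :> rat /\
  1 < (pdeg S)%:R / (pdeg P)%:R :> rat.
Proof.
have two0 : (2 : F) != 0.
  have charF : p \in [pchar F] by apply: card_finPcharP hF hp.
  apply: contraTneq hodd => F2.
  have : 2%N \in [pchar F] by rewrite inE /= F2.
  by rewrite (pcharf_eq charF) => /eqP <-.
have P0 : P != 0 by apply: irredp_neq0.
have G0 : H * P != 0 by rewrite mulf_neq0.
have degP : (0 < pdeg P)%N by case: hP => szP _; rewrite /pdeg -subn1 subn_gt0.
have eqD : D = (S * (H * P)) ^+ 2 + c *: S by rewrite hD mulrA.
have S1 : (1 < size S)%N by rewrite -subn_gt0 subn1; apply: leq_ltn_trans hdeg.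
(* The case [A = 0] of [small_norm_square]: then [z = 0] divides both [x] and [y]. *)
have norm_eq0 x y : x ^+ 2 - D * y ^+ 2 = 0 -> x = 0 /\ y = 0.
  rewrite eqD => N0; have [|z [/esym/eqP z0 zx zy]] :=
    @small_norm_square _ S (H * P) 0 c x y two0 hc G0 S1 _ N0.
    by rewrite size_poly0 ltnW.
  move: z0 zx zy; rewrite sqrf_eq0 => /eqP ->.
  by rewrite !dvd0p => /eqP -> /eqP ->.
have intP := ring_of_integersP F K D sqrtD two0 hsqf hsqrtD hK norm_eq0.
have [PnS [b0 Pb0]] : ~~ (P %| c *: S) /\ exists b0, P %| b0 ^+ 2 - c *: S.
  by move: hres; rewrite /qr_symbol; case: ifP => // _; case: asboolP.
have Pb0' : ~~ (P %| b0).
  apply: contraNN PnS => Pdb; have -> : c *: S = b0 * b0 - (b0 ^+ 2 - c *: S) by ring.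
  by rewrite dvdp_sub // dvdp_mulr.
(* The largest [m] with [m deg P < deg S]; thus [m.+1] is [deg S / deg P] rounded up. *)
pose m := ((pdeg S).-1 %/ pdeg P)%N.
have [b Pbb PM] : exists2 b, P %| b - b0 & P ^+ m.+1 %| b ^+ 2 - D.
  apply: hensel_sqrt => //.
    by rewrite -polyC_natr mul_polyC dvdpZr.
  have -> : b0 ^+ 2 - D = (b0 ^+ 2 - c *: S) - S * (H * P) * (S * H) * P.
    by rewrite eqD; ring.
  by rewrite dvdp_sub // dvdp_mull.
have Pb : ~~ (P %| b).
  by apply: contraNN Pb0' => Pdb; rewrite -(subKr b b0) dvdp_sub.
pose I (i : 'I_m.+1) := prime_power_ideal F K sqrtD P b i.
have fI i : fractional_ideal (I i).
  by apply: prime_power_fractional hsqrtD _ _ _ _ _ PM _ _ => //; apply: ltnW.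
have neqI (i j : 'I_m.+1) : (i < j)%N -> ideal_class (I i) <> ideal_class (I j).
  move=> ij; apply: (prime_power_class_neq F K D sqrtD two0 hsqrtD norm_eq0 intP
    P b m.+1 hP Pb PM S (H * P) c i j eqD hc G0).
    by rewrite ij ltnW.
  apply: leq_ltn_trans (_ : m * pdeg P < _)%N.
    by rewrite leq_mul2r; apply/orP; right; rewrite (leq_trans (leq_subr _ _)) // -ltnS.
  apply: leq_ltn_trans (leq_divM _ _) _.
  by rewrite prednK // (leq_ltn_trans _ hdeg).
have injI : injective (fun i => ideal_class (I i)).
  move=> i j eqI; apply: ord_inj; case: (ltngtP i j) => // [ij|ji].
    by case: (neqI i j ij eqI).
  by case: (neqI j i ji (esym eqI)).
have le_h : (m.+1 <= class_number K)%N.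
  have <- : #|` [fset ideal_class (I i) | i in 'I_m.+1]%fset|%fset = m.+1.
    by rewrite (card_imfset _ _ injI) /= -cardE card_ord.
  apply: fsubset_leq_card; apply/fsubsetP => C /imfsetP [i _ ->].
  (* Finiteness of the class group enters here, since [fset_set] of an infinite set is empty. *)
  rewrite in_fset_set; first by rewrite inE; exists (I i).
  exact: ideal_class_group_finite hsqrtD norm_eq0 intP.
have degP' : 0 < (pdeg P)%:R :> rat by rewrite ltr0n.
split; last by rewrite ltr_pdivlMr // mul1r ltr_nat.
rewrite ler_pdivrMr // -natrM ler_nat.
apply: leq_trans (leq_mul le_h (leqnn _)).
by rewrite -[leqLHS](ltn_predK hdeg) ltn_ceil.
Qed.
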